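(* Let $n\ge2$ and let $T_1$ and $T_2$ be arbitrary trees in the same interval of $\mathscr{C}_n$. Then their meet $T_1\wedge T_2$ and join $T_1\vee T_2$ in $\mathscr{C}_n$ are the trees whose weight vectors are, respectively, the componentwise minimum and the componentwise maximum of the weight vectors $\langle T_1\rangle$ and $\langle T_2\rangle$.
   Context: $\mathbb{T}_n$ is the set of all full plane binary trees with $n$ leaves (every internal vertex has exactly a left child and a right child); the leaves are labeled $a_1,\ldots,a_n$ from left to right. For $T\in\mathbb{T}_n$, the reduced parenthesization $RP_T$ is the set of all subsets of $\{a_1,\ldots,a_n\}$ (including singletons) which are leaf sets of the subtrees of $T$ rooted at vertices of $T$ and which do not contain $a_n$. The (right) comb poset $\mathscr{C}_n$ is the set $\mathbb{T}_n$ ordered by $T_1\le T_2$ if and only if $RP_{T_1}\subseteq RP_{T_2}$. It has a least element, so two trees lie in the same interval exactly when they have a common upper bound. $\wedge,\vee$ denote meet and join in $\mathscr{C}_n$. Weight vector: for $i\in\{1,\ldots,n-1\}$ let $w_T(i)$ be the maximum of $|E|$ over all $E\in RP_T$ whose element of largest index is $a_i$. The weight vector of $T$ is $\langle T\rangle=(w_T(1),\ldots,w_T(n-1))$. A tree in $\mathbb{T}_n$ is determined by its weight vector. *)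

(* Defs.v *)
From HB Require Import structures.
From mathcomp Require Import all_boot all_order.
From mathcomp Require Import zify.

Set Implicit Arguments.
Unset Strict Implicit.
Unset Printing Implicit Defensive.

Import Order.TTheory.

Inductive btree : Type := Leaf | Node of btree & btree.

Fixpoint btree_encode (t : btree) : GenTree.tree unit :=
  match t with
  | Leaf => GenTree.Leaf tt
  | Node l r => GenTree.Node 0 [:: btree_encode l; btree_encode r]
  end.

Fixpoint btree_decode (g : GenTree.tree unit) : option btree :=
  match g with
  | GenTree.Leaf _ => Some Leaf
  | GenTree.Node _ [:: g1; g2] =>
      match btree_decode g1, btree_decode g2 with
      | Some l, Some r => Some (Node l r)
      | _, _ => None
      end
  | _ => None
  end.

Lemma btree_encodeK : pcancel btree_encode btree_decode.
Proof. by elim=> [|l IHl r IHr] //=; rewrite IHl IHr. Qed.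

HB.instance Definition _ := Countable.copy btree (pcan_type btree_encodeK).

Fixpoint nleaves (t : btree) : nat :=
  match t with Leaf => 1 | Node l r => nleaves l + nleaves r end.

(* The leaves of [t], labeled k, k+1, ... from left to right. *)
Fixpoint leaf_labels (k : nat) (t : btree) : seq nat :=
  match t with
  | Leaf => [:: k]
  | Node l r => leaf_labels k l ++ leaf_labels (k + nleaves l) r
  end.

(* The leaf sets of the subtrees rooted at the vertices of [t], one entry for
   each vertex, when the leaves are labeled from k on. *)
Fixpoint subtree_labels (k : nat) (t : btree) : seq (seq nat) :=
  leaf_labels k t ::
  match t with
  | Leaf => [::]
  | Node l r => subtree_labels k l ++ subtree_labels (k + nleaves l) r
  end.

Record comb (n : nat) : Type :=
  Comb { comb_tree :> btree; comb_treeP : nleaves comb_tree == n }.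

HB.instance Definition _ n := [isSub of comb n for @comb_tree n].
HB.instance Definition _ n := [Countable of comb n by <:].

(* Indices are 0-based: the leaf a_(i+1) is the ordinal i : 'I_n, so that a_n
   has value n.-1. *)
Definition RP (n : nat) (T : comb n) : {set {set 'I_n}} :=
  [set E : {set 'I_n} |
    (E \in [seq [set i : 'I_n | val i \in s] | s <- subtree_labels 0 T])
    && [forall i in E, val i != n.-1]].

Definition largest_index (n : nat) (E : {set 'I_n}) (i : nat) : bool :=
  [exists j in E, val j == i] && [forall j in E, val j <= i].

(* [weight T i] is w_T(i+1). *)
Definition weight (n : nat) (T : comb n) : {ffun 'I_n.-1 -> nat} :=
  [ffun i : 'I_n.-1 => \max_(E in RP T | largest_index E i) #|E|].

Lemma nleaves_gt0 t : 0 < nleaves t.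
Proof. by elim: t => //= l IHl r IHr; rewrite addn_gt0 IHl. Qed.

Lemma leaf_labelsE k t : leaf_labels k t = iota k (nleaves t).
Proof. by elim: t k => [|l IHl r IHr] k //=; rewrite IHl IHr iotaD. Qed.

Lemma mem_subtree_labels k t s : s \in subtree_labels k t ->
  exists a m, [/\ s = iota a m, 0 < m, k <= a & a + m <= k + nleaves t].
Proof.
elim: t k s => [|l IHl r IHr] k s.
  by rewrite /= inE => /eqP ->; exists k, 1; split.
rewrite [subtree_labels _ _]/= inE mem_cat => /or3P[/eqP ->||].
- exists k, (nleaves l + nleaves r); split => //=.
    by rewrite !leaf_labelsE -iotaD.
  by rewrite addn_gt0 nleaves_gt0.
- by move=> /IHl[a [m [-> ? ? ?]]]; exists a, m; split => //=; lia.
- by move=> /IHr[a [m [-> ? ? ?]]]; exists a, m; split => //=; lia.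
Qed.

Lemma subtree_labels_root k t : iota k (nleaves t) \in subtree_labels k t.
Proof. by case: t => [|l r]; rewrite /= inE // !leaf_labelsE -iotaD eqxx. Qed.

Lemma iota_inj a m b p : 0 < m -> iota a m = iota b p -> a = b /\ m = p.
Proof.
move=> m0 e; have e2 : m = p by rewrite -(size_iota a m) e size_iota.
by subst p; split => //; case: m m0 e => // m _ [].
Qed.

Lemma subtree_labels_nodeP k l r a m : 0 < m ->
  a + m < k + nleaves l + nleaves r ->
  (iota a m \in subtree_labels k (Node l r)) =
  if a < k + nleaves l then iota a m \in subtree_labels k l
  else iota a m \in subtree_labels (k + nleaves l) r.
Proof.
move=> m0 lt; rewrite [subtree_labels _ _]/= inE mem_cat.
have -> /= : (iota a m == leaf_labels k l ++ leaf_labels (k + nleaves l) r)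
   = false.
  by rewrite !leaf_labelsE -iotaD; apply/eqP => /(iota_inj m0); lia.
case: ifP => h.
  apply: orb_idr => /mem_subtree_labels[b [p [/(iota_inj m0)]]]; lia.
apply: orb_idl => /mem_subtree_labels[b [p [/(iota_inj m0)]]]; lia.
Qed.

Lemma subtree_labels_inj k t1 t2 : nleaves t1 = nleaves t2 ->
  (forall a m, 0 < m -> a + m < k + nleaves t1 ->
     (iota a m \in subtree_labels k t1) = (iota a m \in subtree_labels k t2)) ->
  t1 = t2.
Proof.
elim: t1 k t2 => [|l1 IHl r1 IHr] k [|l2 r2] //= eqn H.
- by have := nleaves_gt0 l2; have := nleaves_gt0 r2; lia.
- by have := nleaves_gt0 l1; have := nleaves_gt0 r1; lia.
have {}H a m : 0 < m -> a + m < k + nleaves l1 + nleaves r1 ->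
    (iota a m \in subtree_labels k (Node l1 r1)) =
    (iota a m \in subtree_labels k (Node l2 r2)).
  by move=> m0 h; apply: H => //; lia.
have [l1p l2p] := (nleaves_gt0 l1, nleaves_gt0 l2).
have [r1p r2p] := (nleaves_gt0 r1, nleaves_gt0 r2).
have eql : nleaves l1 = nleaves l2.
  have le12 : nleaves l1 <= nleaves l2.
    have := H k (nleaves l1) l1p; rewrite !subtree_labels_nodeP; try lia.
    rewrite !ifT ?subtree_labels_root; try lia.
    move=> /(_ ltac:(lia))/esym/mem_subtree_labels.
    by case=> b [p [/(iota_inj l1p)]]; lia.
  have le21 : nleaves l2 <= nleaves l1.
    have := H k (nleaves l2) l2p; rewrite !subtree_labels_nodeP; try lia.
    rewrite !ifT ?subtree_labels_root; try lia.
    move=> /(_ ltac:(lia))/mem_subtree_labels.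
    by case=> b [p [/(iota_inj l2p)]]; lia.
  by lia.
congr Node.
- apply: (IHl k) => // a m m0 h.
  have := H a m m0; rewrite !subtree_labels_nodeP; try lia.
  by rewrite !ifT; try lia; move=> ->; lia.
- apply: (IHr (k + nleaves l1)) => [|a m m0 h]; first by lia.
  case: (ltnP a (k + nleaves l1)) => ha.
    transitivity false; [|symmetry]; apply/negP;
      move=> /mem_subtree_labels[b [p [/(iota_inj m0)]]]; lia.
  have := H a m m0; rewrite !subtree_labels_nodeP; try lia.
  by rewrite !ifF -?eql; try lia; move=> ->; lia.
Qed.

Lemma iota_set_inj n a m b p : 0 < m -> a + m <= n -> 0 < p -> b + p <= n ->
  [set i : 'I_n | val i \in iota a m] = [set i : 'I_n | val i \in iota b p] ->
  a = b /\ m = p.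
Proof.
move=> m0 am p0 bp /setP e.
have {}e j : j < n -> (j \in iota a m) = (j \in iota b p).
  by move=> jn; have := e (Ordinal jn); rewrite !inE.
have := e a; have := e b; have := e (a + m).-1; have := e (b + p).-1.
rewrite !mem_iota => e1 e2 e3 e4.
have h1 := e1 ltac:(lia); have h2 := e2 ltac:(lia).
have h3 := e3 ltac:(lia); have h4 := e4 ltac:(lia).
by clear -m0 p0 h1 h2 h3 h4; lia.
Qed.

Lemma mem_RP n (T : comb n) a m : 0 < m -> a + m < n ->
  ([set i : 'I_n | val i \in iota a m] \in RP T) =
  (iota a m \in subtree_labels 0 T).
Proof.
move=> m0 lt; rewrite inE.
have -> : [forall i in [set i : 'I_n | val i \in iota a m], val i != n.-1].
  by apply/forall_inP => i; rewrite inE mem_iota => /andP[_ /= h]; lia.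
rewrite andbT; apply/mapP/idP => [[s sT]|h]; last by exists (iota a m).
have [b [p [es p0 _ bp]]] := mem_subtree_labels sT; rewrite es in sT *.
have := comb_treeP T => /eqP eT.
by move=> /(@iota_set_inj n)[||||-> ->] //; lia.
Qed.

Lemma RP_inj n : injective (@RP n).
Proof.
move=> T1 T2 e; apply: val_inj; apply: (@subtree_labels_inj 0) => [|a m m0].
  by rewrite (eqP (comb_treeP T1)) (eqP (comb_treeP T2)).
by rewrite add0n (eqP (comb_treeP T1)) => lt; rewrite -!mem_RP ?e.
Qed.

Definition comb_le (n : nat) : rel (comb n) := fun T1 T2 => RP T1 \subset RP T2.

Lemma comb_le_refl n : reflexive (@comb_le n).
Proof. by move=> T; apply: subxx. Qed.

Lemma comb_le_anti n : antisymmetric (@comb_le n).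
Proof. by move=> T1 T2; rewrite -eqEsubset => /eqP /RP_inj. Qed.

Lemma comb_le_trans n : transitive (@comb_le n).
Proof. by move=> T2 T1 T3; apply: subset_trans. Qed.

Fact comb_display : Order.disp_t. Proof. exact: Order.Disp tt tt. Qed.

HB.instance Definition _ n := Order.Le_isPOrder.Build comb_display (comb n)
  (@comb_le_refl n) (@comb_le_anti n) (@comb_le_trans n).

Section Bounds.
Local Open Scope order_scope.
Context {d : Order.disp_t} {P : porderType d}.

(* Meets and joins as partial operations: the comb poset is not a lattice. *)
Definition is_meet (x y m : P) : Prop :=
  [/\ m <= x, m <= y & forall z, z <= x -> z <= y -> z <= m].

Definition is_join (x y j : P) : Prop :=
  [/\ x <= j, y <= j & forall z, x <= z -> y <= z -> j <= z].

Definition same_interval (x y : P) : Prop :=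
  exists a b, (a <= x <= b) /\ (a <= y <= b).

End Bounds.

(* Main.v *)
(* A reduced parenthesization is a laminar family of intervals which is maximal
   below each of its members.  Hence, below a common upper bound U, the families
   RP T1 and RP T2 are closed under passing to smaller members of RP U, and so
   are their intersection and union; each such closed subfamily is the reduced
   parenthesization of the tree obtained from U by dissolving the missing
   vertices into the right spine.  Meet and join are thus intersection and
   union.  Of two members of RP U with the same last leaf one contains the
   other, which turns these into minimum and maximum of the weights. *)
Require Import Defs.
From mathcomp Require Import all_boot all_order.
From mathcomp Require Import zify.

Set Implicit Arguments.
Unset Strict Implicit.
Unset Printing Implicit Defensive.

Import Order.TTheory.

(** * Vertices of a tree as intervals of leaf labels *)

Definition node (k : nat) (t : btree) (a m : nat) : bool :=
  iota a m \in subtree_labels k t.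

Lemma node_bounds k t a m : node k t a m ->
  [/\ 0 < m, k <= a & a + m <= k + nleaves t].
Proof.
by move=> /mem_subtree_labels[b [p [e p0 kb bp]]];
  have [<- <-] := iota_inj p0 (esym e).
Qed.

Lemma node_leaf k a m : node k Leaf a m = (a == k) && (m == 1).
Proof.
rewrite /node /= inE; apply/eqP/andP => [e|[/eqP-> /eqP->]] //.
by have [-> ->] := @iota_inj k 1 a m isT (esym e).
Qed.

Lemma node_root k t : node k t k (nleaves t).
Proof. exact: subtree_labels_root. Qed.

Lemma node_Node k l r a m :
  node k (Node l r) a m =
  [|| (a == k) && (m == nleaves l + nleaves r), node k l a m
    | node (k + nleaves l) r a m].
Proof.
rewrite /node [subtree_labels _ _]/= inE mem_cat; congr (_ || _).
rewrite !leaf_labelsE -iotaD; apply/eqP/andP => [e|[/eqP-> /eqP->]] //.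
have lr : 0 < nleaves l + nleaves r by rewrite addn_gt0 nleaves_gt0.
by have [-> ->] := iota_inj lr (esym e).
Qed.

Lemma node_leaf_label k t a : k <= a < k + nleaves t -> node k t a 1.
Proof.
elim: t k => [|l IHl r IHr] k /= h.
  by rewrite node_leaf andbT; lia.
rewrite node_Node; case: (ltnP a (k + nleaves l)) => ha.
  by rewrite IHl ?orbT //; lia.
by rewrite IHr ?orbT //; lia.
Qed.

(* The intervals [a, a + m) and [b, b + p) overlap, [a, a + m) being the left
   one, and neither contains the other. *)
Definition cross (a m b p : nat) : bool := [&& a < b, b < a + m & a + m < b + p].

Lemma node_noncross k t a m b p :
  node k t a m -> node k t b p -> ~~ cross a m b p.
Proof.
rewrite /cross; elim: t k => [|l IHl r IHr] k.
  by rewrite !node_leaf; lia.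
rewrite !node_Node.
move=> /or3P[/andP[/eqP-> /eqP->]|ha|ha] /or3P[/andP[/eqP-> /eqP->]|hb|hb].
all: try by [exact: IHl ha hb | exact: IHr ha hb].
all: try (have [] := node_bounds ha); try (have [] := node_bounds hb); lia.
Qed.

(** Descend from [(a, m)]: while [[b, b + p)] fits into the left or the right child, pass to that
    child. Once it straddles the split, not crossing the left child forces it to start where the
    current vertex starts, and not crossing the right child forces it to end where that vertex
    ends. *)
Lemma node_maximal k t a m b p :
  node k t a m -> 0 < p -> a <= b -> b + p <= a + m ->
  (forall c q, node k t c q -> a <= c -> c + q <= a + m ->
     ~~ cross c q b p && ~~ cross b p c q) ->
  node k t b p.
Proof.
elim: t k a m => [|l IHl r IHr] k a m.
  by rewrite !node_leaf => /andP[/eqP-> /eqP->] *; apply/andP; lia.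
have [lp rp] := (nleaves_gt0 l, nleaves_gt0 r).
have sl c q : node k l c q -> node k (Node l r) c q.
  by rewrite node_Node => ->; rewrite orbT.
have sr c q : node (k + nleaves l) r c q -> node k (Node l r) c q.
  by rewrite node_Node => ->; rewrite !orbT.
rewrite node_Node => /or3P[/andP[/eqP-> /eqP->]|ha|ha] p0 ab bp nc.
- case: (leqP (b + p) (k + nleaves l)) => hl.
    apply/sl/(IHl k k (nleaves l)) => //; first exact: node_root.
    by move=> c q h ? ?; apply: nc; [exact: sl | lia | lia].
  case: (leqP (k + nleaves l) b) => hr.
    apply/sr/(IHr _ (k + nleaves l) (nleaves r)) => //; first exact: node_root.
      by lia.
    by move=> c q h ? ?; apply: nc; [exact: sr | lia | lia].
  have := nc _ _ (sl _ _ (node_root k l)).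
  have := nc _ _ (sr _ _ (node_root (k + nleaves l) r)).
  by rewrite node_Node /cross => h1 h2; apply/or3P/Or31; lia.
- by apply/sl/(IHl _ a m) => // c q h; apply: nc; exact: sl.
- by apply/sr/(IHr _ a m) => // c q h; apply: nc; exact: sr.
Qed.

(** * Dissolving vertices into the right spine *)

(* Attaches to [rest] the maximal subtrees of [l] selected by [P]. *)
Fixpoint graft (P : nat -> nat -> bool) (k : nat) (l rest : btree) : btree :=
  match l with
  | Leaf => Node Leaf rest
  | Node l1 l2 =>
      if P k (nleaves l) then Node l rest
      else graft P k l1 (graft P (k + nleaves l1) l2 rest)
  end.

(** [P] is tested only on subtrees hanging to the left of the right spine: the spine vertices
    contain the last leaf and so never contribute to [RP]. *)
Fixpoint prune (P : nat -> nat -> bool) (k : nat) (t : btree) : btree :=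
  match t with
  | Leaf => Leaf
  | Node l r => graft P k l (prune P (k + nleaves l) r)
  end.

Lemma nleaves_graft P k l rest :
  nleaves (graft P k l rest) = nleaves l + nleaves rest.
Proof.
elim: l k rest => [|l1 IH1 l2 IH2] k rest //=.
by case: ifP => // _; rewrite IH1 IH2 addnA.
Qed.

Lemma nleaves_prune P k t : nleaves (prune P k t) = nleaves t.
Proof. by elim: t k => [|l _ r IHr] k //=; rewrite nleaves_graft IHr. Qed.

(** A selected subtree is kept whole, which is right because [P] passes down to all its vertices; a
    rejected one is replaced by its two children. The bound on [a + m] excludes the new spine
    vertices, which all reach the end of [rest]. *)
Lemma node_graft (P : nat -> nat -> bool) k l rest a m :
  (forall c, node k l c 1 -> P c 1) ->
  (forall c q d p, node k l c q -> node k l d p -> c <= d -> d + p <= c + q ->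
     P c q -> P d p) ->
  a + m < k + nleaves l + nleaves rest ->
  node k (graft P k l rest) a m =
  node k l a m && P a m || node (k + nleaves l) rest a m.
Proof.
elim: l k rest => [|l1 IH1 l2 IH2] k rest P1 Pcl lt.
  rewrite /= in lt *; rewrite node_Node /= node_leaf.
  have [/andP[/eqP ea /eqP em]|_] := boolP ((a == k) && (m == 1)); last first.
    by rewrite [_ && _](_ : _ = false) //; lia.
  by rewrite ea em P1 ?orbT // node_leaf !eqxx.
rewrite [graft _ _ _ _]/=; case: ifP => hP.
  rewrite node_Node [X in X || _](_ : _ = false) /=; last by simpl in *; lia.
  congr (_ || _); apply/idP/andP => [h|[]//]; split=> //.
  have [_ ? ?] := node_bounds h.
  exact: (Pcl k _ a m (node_root k _)).
have s1 c q : node k l1 c q -> node k (Node l1 l2) c q.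
  by rewrite node_Node => ->; rewrite orbT.
have s2 c q : node (k + nleaves l1) l2 c q -> node k (Node l1 l2) c q.
  by rewrite node_Node => ->; rewrite !orbT.
rewrite IH1 ?nleaves_graft; first last.
- by simpl in *; lia.
- by move=> c q d p /s1 ? /s1 ?; apply: Pcl.
- by move=> c /s1; apply: P1.
rewrite IH2; first last.
- by simpl in *; lia.
- by move=> c q d p /s2 ? /s2 ?; apply: Pcl.
- by move=> c /s2; apply: P1.
rewrite node_Node -addnA orbA -andb_orl; congr (_ || _).
have [/andP[/eqP-> /eqP->]|//] := boolP ((a == k) && _).
by rewrite /= in hP *; rewrite hP !andbF.
Qed.

Lemma node_prune (P : nat -> nat -> bool) k t a m :
  (forall c, k <= c < k + nleaves t -> P c 1) ->
  (forall c q d p, node k t c q -> node k t d p -> c <= d -> d + p <= c + q ->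
     c + q < k + nleaves t -> P c q -> P d p) ->
  a + m < k + nleaves t ->
  node k (prune P k t) a m = node k t a m && P a m.
Proof.
elim: t k => [|l _ r IHr] k P1 Pcl lt.
  by rewrite /= !node_leaf in lt *; lia.
have rp := nleaves_gt0 r.
have sl c q : node k l c q -> node k (Node l r) c q.
  by rewrite node_Node => ->; rewrite orbT.
have sr c q : node (k + nleaves l) r c q -> node k (Node l r) c q.
  by rewrite node_Node => ->; rewrite !orbT.
rewrite [prune _ _ _]/= node_graft; first last.
- by rewrite nleaves_prune; simpl in *; lia.
- move=> c q d p h h' ? ?; have [_ _ ?] := node_bounds h.
  by apply: Pcl => //; [exact: sl | exact: sl | simpl; lia].
- by move=> c /node_bounds[_ ? ?]; apply: P1; simpl; lia.
rewrite IHr; first last.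
- by simpl in *; lia.
- move=> c q d p /sr h /sr h' ? ? ?.
  by apply: Pcl => //; simpl; lia.
- by move=> c ?; apply: P1; simpl; lia.
rewrite node_Node -andb_orl [X in _ = (X || _) && _](_ : _ = false) //.
by simpl in *; lia.
Qed.

(** * Reduced parenthesizations and weights in terms of intervals *)

Section Comb.
Variable n : nat.
Implicit Types T U : comb n.

Lemma comb_bounds T a m : node 0 T a m -> 0 < m /\ a + m <= n.
Proof. by case/node_bounds; rewrite (eqP (comb_treeP T)). Qed.

Lemma in_RP T E : E \in RP T ->
  exists a m, [/\ 0 < m, a + m < n, node 0 T a m
                & E = [set i : 'I_n | val i \in iota a m]].
Proof.
rewrite inE => /andP[/mapP[s sT ->] /forall_inP h].
have [a [m [es m0 _]]] := mem_subtree_labels sT.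
rewrite es (eqP (comb_treeP T)) in sT h * => am.
exists a, m; split=> //.
have lt : (a + m).-1 < n by lia.
have := h (Ordinal lt); rewrite inE mem_iota /=; lia.
Qed.

(** Here [a + m < n] expresses that the interval misses the last leaf. *)
Lemma comb_leP T1 T2 :
  reflect (forall a m, a + m < n -> node 0 T1 a m -> node 0 T2 a m)
          (RP T1 \subset RP T2).
Proof.
apply: (iffP subsetP) => [h a m am h1 | h E /in_RP[a [m [m0 am h1 ->]]]].
  have [m0 _] := comb_bounds h1.
  by rewrite /node -mem_RP //; apply: h; rewrite mem_RP.
by rewrite mem_RP //; apply: h.
Qed.

Lemma card_iota_set a m : a + m <= n ->
  #|[set i : 'I_n | val i \in iota a m]| = m.
Proof.
move=> am; rewrite cardE -(size_map val) -[RHS](size_iota a).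
apply/perm_size/uniq_perm.
- by rewrite (map_inj_uniq val_inj) enum_uniq.
- exact: iota_uniq.
move=> j; apply/mapP/idP => [[i + ->]|hj]; first by rewrite mem_enum inE.
have jn : j < n by rewrite mem_iota in hj; lia.
by exists (Ordinal jn) => //; rewrite mem_enum inE.
Qed.

Lemma largest_index_iota a m i : 0 < m -> a + m <= n ->
  largest_index [set j : 'I_n | val j \in iota a m] i = (a + m == i.+1).
Proof.
move=> m0 am; apply/andP/eqP => [[/exists_inP[j]]|e].
  rewrite inE mem_iota /= => /andP[h1 h2] /eqP <- /forall_inP h.
  have lt : (a + m).-1 < n by lia.
  by have := h (Ordinal lt); rewrite inE mem_iota /=; lia.
have lt : i < n by lia.
split; first by apply/exists_inP; exists (Ordinal lt);
  rewrite //= inE mem_iota /=; lia.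
by apply/forall_inP => j; rewrite inE mem_iota /=; lia.
Qed.

(** Weights are handled through their strict lower bounds, so that no interval attaining the maximum
    has to be chosen. Indices being 0-based, an interval whose last leaf is [i] has [a + m = i.+1],
    which is below [n]. *)
Lemma ltn_weight T (i : 'I_n.-1) w :
  reflect (exists a m, [/\ w < m, a + m = i.+1 & node 0 T a m])
          (w < weight T i).
Proof.
have lti := ltn_ord i.
rewrite ffunE ltnNge; apply: (iffP negP) => [h|[a [m [wm e h]]] /bigmax_leqP le].
  have [E /and3P[ER Ei wE]|none] := pickP (fun E =>
      [&& E \in RP T, largest_index E i & w < #|E|]).
    have [a [m [m0 am nd e]]] := in_RP ER; subst E.
    rewrite card_iota_set ?largest_index_iota // in wE Ei; try lia.
    by exists a, m; rewrite (eqP Ei).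
  case: h; apply/bigmax_leqP => E /andP[ER Ei].
  by have := none E; rewrite ER Ei /= ltnNge => /negbFE.
have [m0 am] := comb_bounds h.
have := le [set i : 'I_n | val i \in iota a m].
rewrite mem_RP ?largest_index_iota ?card_iota_set ?e //; try lia.
by rewrite /node in h; rewrite h eqxx => /(_ isT); lia.
Qed.

(** The vertices of [T] inside [[a, a + m)] are also vertices of [U], so none of them crosses
    [[b, b + p)], and [node_maximal] applies in [T]. *)
Lemma node_below T U a m b p : RP T \subset RP U -> a + m < n ->
  node 0 T a m -> node 0 U b p -> a <= b -> b + p <= a + m -> node 0 T b p.
Proof.
move=> /comb_leP TU am hT hU ab bp; have [p0 _] := comb_bounds hU.
apply: (node_maximal hT) => // c q hc ac cq.
have {}hc : node 0 U c q by apply: TU => //; lia.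
by rewrite !(node_noncross (k := 0) (t := U)).
Qed.

(** With equal weights, each member of [RP T1] lies in a member of [RP T2] with the same last leaf.
    It crosses no vertex of [T2] inside the latter, so [node_maximal] makes it a vertex of [T2]. *)
Lemma weight_inj : injective (@weight n).
Proof.
suff le T1 T2 : weight T1 = weight T2 -> RP T1 \subset RP T2.
  by move=> T1 T2 e; apply/RP_inj/eqP; rewrite eqEsubset !le.
move=> e; apply/comb_leP => b p bp h; have [p0 _] := comb_bounds h.
have iP : (b + p).-1 < n.-1 by lia.
(* The weight is at least [p], written strictly to fit [ltn_weight]; [(b + p).-1] is the last leaf
   of the interval. *)
have : p.-1 < weight T1 (Ordinal iP).
  by apply/ltn_weight; exists b, p; split => //=; lia.
rewrite e => /ltn_weight[a [m [/= pm am ha]]].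
apply: (node_maximal ha) => //; try lia.
move=> c q hc ac cq; rewrite /cross.
(* A member (c, q) of RP T2 ends no later than (b, p), so it can only cross it
   on the left; the member of RP T1 of maximal weight ending where (c, q) ends
   would then cross (b, p) as well. *)
have [q0 _] := comb_bounds hc.
have jP : (c + q).-1 < n.-1 by lia.
have : q.-1 < weight T2 (Ordinal jP).
  by apply/ltn_weight; exists c, q; split => //=; lia.
rewrite -e => /ltn_weight[d [r [/= qr dr hd]]].
by have := node_noncross hd h; rewrite /cross; lia.
Qed.

Lemma comb_prune U (P : nat -> nat -> bool) :
  (forall c, c < n -> P c 1) ->
  (forall c q d p, node 0 U c q -> node 0 U d p -> c <= d -> d + p <= c + q ->
     c + q < n -> P c q -> P d p) ->
  exists T : comb n,
    forall a m, a + m < n -> node 0 T a m = node 0 U a m && P a m.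
Proof.
move=> P1 Pcl; have Un := eqP (comb_treeP U).
have tP : nleaves (prune P 0 U) == n by rewrite nleaves_prune Un.
by exists (Comb tP) => a m am; rewrite [LHS]node_prune ?Un.
Qed.

End Comb.

Theorem theorem5p3 (n : nat) (hn : 2 <= n) (T1 T2 : comb n)
    (h12 : same_interval T1 T2) :
  exists M J : comb n,
    [/\ is_meet T1 T2 M,
        unique (fun T : comb n =>
          weight T = [ffun i => minn (weight T1 i) (weight T2 i)]) M,
        is_join T1 T2 J
      & unique (fun T : comb n =>
          weight T = [ffun i => maxn (weight T1 i) (weight T2 i)]) J].
Proof.
have {h12} [U [le1 le2]] : exists U : comb n,
    RP T1 \subset RP U /\ RP T2 \subset RP U.
  by have [_ [U [/andP[_ h1] /andP[_ h2]]]] := h12; exists U.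
have [sub1 sub2] := (comb_leP _ _ le1, comb_leP _ _ le2).
have leaf (T : comb n) c : c < n -> node 0 T c 1.
  by move=> cn; apply: node_leaf_label; rewrite (eqP (comb_treeP T)).
have [M {}HM] : exists M : comb n, forall a m, a + m < n ->
    node 0 M a m = node 0 T1 a m && node 0 T2 a m.
  have [|c q d p _ hd cd dp cq /andP[h1 h2]|M HM] :=
      @comb_prune n U (fun a m => node 0 T1 a m && node 0 T2 a m).
  - by move=> c cn; rewrite !leaf.
  - by rewrite (node_below le1 cq h1 hd) ?(node_below le2 cq h2 hd).
  exists M => a m am; rewrite HM //; apply: andb_idl => /andP[h _].
  exact: sub1.
have [J HJ] : exists J : comb n, forall a m, a + m < n ->
    node 0 J a m = node 0 T1 a m || node 0 T2 a m.
  (* The union is closed under smaller members of [RP U] because each family is closed by itself. *)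
  have [|c q d p _ hd cd dp cq /orP[h|h]|J HJ] :=
      @comb_prune n U (fun a m => node 0 T1 a m || node 0 T2 a m).
  - by move=> c cn; rewrite !leaf.
  - by rewrite (node_below le1 cq h hd).
  - by rewrite (node_below le2 cq h hd) ?orbT.
  exists J => a m am; rewrite HJ //; apply: andb_idl => /orP[]; first exact: sub1.
  exact: sub2.
have unique_weight (T : comb n) w : (weight T =1 w) ->
    unique (fun T' : comb n => weight T' = [ffun i => w i]) T.
  move=> Tw; have e : weight T = [ffun i => w i].
    by apply/ffunP => i; rewrite Tw ffunE.
  by split=> // T'; rewrite -e => /esym /weight_inj.
have eq_ltn x y : (forall w, (w < x) = (w < y)) -> x = y.
  by move=> h; have := h x; have := h y; lia.
exists M, J; split.
- split=> [||Z /comb_leP h1 /comb_leP h2]; apply/comb_leP => a m am.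
  + by rewrite HM // => /andP[].
  + by rewrite HM // => /andP[].
  + by move=> h; rewrite HM // h1 // h2.
- apply: unique_weight => i; apply: eq_ltn => w; have lti := ltn_ord i.
  rewrite leq_min; apply/ltn_weight/andP.
    move=> [a [m [wm e]]]; rewrite HM; last by lia.
    by move=> /andP[h1 h2]; split; apply/ltn_weight; exists a, m.
  move=> [/ltn_weight[a [m [wm am h1]]] /ltn_weight[b [p [wp bp h2]]]].
  (* Both intervals end at leaf [i], so the shorter lies inside the longer; by [node_below] it is
     then a vertex of both trees. *)
  case: (leqP m p) => mp.
    exists a, m; rewrite HM; last by lia.
    by rewrite h1 (node_below le2 _ h2 (sub1 _ _ _ h1)) //; lia.
  exists b, p; rewrite HM; last by lia.
  by rewrite h2 (node_below le1 _ h1 (sub2 _ _ _ h2)) //; lia.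
- split=> [||Z /comb_leP h1 /comb_leP h2]; apply/comb_leP => a m am.
  + by rewrite HJ // => ->.
  + by rewrite HJ // => ->; rewrite orbT.
  + by rewrite HJ // => /orP[]; [exact: h1 | exact: h2].
- apply: unique_weight => i; apply: eq_ltn => w; have lti := ltn_ord i.
  rewrite leq_max; apply/ltn_weight/orP.
    move=> [a [m [wm e]]]; rewrite HJ; last by lia.
    by move=> /orP[] h; [left | right]; apply/ltn_weight; exists a, m.
  by case=> /ltn_weight[a [m [wm e h]]]; exists a, m; split=> //;
    rewrite HJ ?h ?orbT //; lia.
Qed.
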